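(* Fix integers $c\ge 2$ and $r\ge 3$, let $\bm a=(a_1,\dots,a_r)\in\{1,\dots,c-1\}^r$ be an admissible $r$-palette, and let $\theta_1,\dots,\theta_{c-1}>0$. Let $X_{r,n}(\bm a)$ be the number of $\bm a$-colorful $r$-APs in the random $c$-coloring of $[n]$ with color probabilities $p_b=n^{-\theta_b}$ for $b\in\{1,\dots,c-1\}$ and $p_c=1-\sum_{b=1}^{c-1}p_b$. Let $S(\bm a)$ be the set of distinct colors appearing in $\bm a$, let $w_b$ be the number of times the color $b\in S(\bm a)$ appears in $\bm a$, and let $\theta_{\max}=\max_{b\in S(\bm a)}\theta_b$. Then, as $n\to\infty$: (i) if $\sum_{b\in S(\bm a)}w_b\theta_b>2$ or $\theta_{\max}>1$, then $X_{r,n}(\bm a)\to 0$ in probability; (ii) if $\sum_{b\in S(\bm a)}w_b\theta_b<2$ and $\theta_{\max}<1$, then $X_{r,n}(\bm a)\to\infty$ in probability.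
   Context: Notation: $[n]=\{1,\dots,n\}$. For an integer $r\ge 3$, an $r$-AP in $[n]$ is an ordered tuple $\bm x=(x,x+d,\dots,x+(r-1)d)$ with $d\ge 1$ an integer and all entries in $[n]$. An $r$-palette is an ordered sequence $\bm a=(a_1,\dots,a_r)\in[c]^r$; it is admissible if $\bm a\in[c-1]^r$, i.e. it avoids color $c$. Given a coloring $\phi_n:[n]\to[c]$, an $r$-AP is $\bm a$-colorful if $\phi_n(x+(s-1)d)=a_s$ for every $s\in[r]$. Random coloring: for $n$ large enough that $\sum_{b=1}^{c-1}n^{-\theta_b}<1$, each element of $[n]$ is independently assigned color $b\in[c]$ with probability $p_b$. The exponents $\theta_1,\dots,\theta_{c-1}>0$ are fixed (not depending on $n$). Convergence $X_n\to\infty$ in probability means $\mathbb P(X_n>M)\to1$ for every $M>0$. *)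

(* Defs.v *)
From HB Require Import structures.
From mathcomp Require Export all_boot all_order all_algebra.
From mathcomp Require Export all_classical all_reals all_analysis.
Export Order.TTheory GRing.Theory Num.Theory.
Export numFieldNormedType.Exports.

Set Implicit Arguments.
Unset Strict Implicit.
Unset Printing Implicit Defensive.

Local Open Scope classical_set_scope.
Local Open Scope ring_scope.

(* Encoding: the integer i in [n] = {1, ..., n} is the ordinal of value i - 1
   in 'I_n, and likewise the color b in [c] is the ordinal of value b - 1 in
   'I_c.  The shift does not affect arithmetic progressions. *)

(* The color is one of 1, ..., c - 1, i.e. it is not color c. *)
Definition proper_color (c : nat) (b : 'I_c) : bool := (b.+1 < c)%N.

Definition admissible (c r : nat) (a : r.-tuple 'I_c) : Prop :=
  forall s : 'I_r, proper_color (tnth a s).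

Definition is_AP (n r : nat) (t : r.-tuple 'I_n) : Prop :=
  exists x d : nat, (1 <= d)%N /\
    forall s : 'I_r, nat_of_ord (tnth t s) = (x + s * d)%N.

Definition colorful (c r n : nat) (phi : 'I_n -> 'I_c) (a : r.-tuple 'I_c)
    (t : r.-tuple 'I_n) : Prop :=
  forall s : 'I_r, phi (tnth t s) = tnth a s.

Definition num_colorful_AP (c r n : nat) (a : r.-tuple 'I_c)
    (phi : 'I_n -> 'I_c) : nat :=
  #|[set t : r.-tuple 'I_n | `[< is_AP t /\ colorful phi a t >]]%SET|.

Definition palette_colors (c r : nat) (a : r.-tuple 'I_c) : {set 'I_c} :=
  [set b in a]%SET.

Definition multiplicity (c r : nat) (a : r.-tuple 'I_c) (b : 'I_c) : nat :=
  count_mem b a.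

(* The default 0 of the iterated maximum is immaterial: the palette is
   nonempty and the exponents of its colors are positive. *)
Definition theta_max (R : realType) (c r : nat) (theta : 'I_c -> R)
    (a : r.-tuple 'I_c) : R :=
  \big[Num.max/0]_(b in palette_colors a) theta b.

Definition weighted_theta (R : realType) (c r : nat) (theta : 'I_c -> R)
    (a : r.-tuple 'I_c) : R :=
  \sum_(b in palette_colors a) (multiplicity a b)%:R * theta b.

(* [theta] is only ever read at the colors 1, ..., c - 1. *)
Definition proper_color_mass (R : realType) (c : nat) (theta : 'I_c -> R)
    (n : nat) : R :=
  \sum_(b : 'I_c | proper_color b) n%:R `^ (- theta b).

Definition color_prob (R : realType) (c : nat) (theta : 'I_c -> R) (n : nat)
    (b : 'I_c) : R :=
  if proper_color b then n%:R `^ (- theta b)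
  else 1 - proper_color_mass theta n.

Definition mutually_independent (R : realType) (d : measure_display)
    (T : measurableType d) (P : probability T R) (I C : finType)
    (X : I -> T -> C) : Prop :=
  forall (J : {set I}) (B : I -> set C),
    P (\bigcap_(i in [set` J]) (X i @^-1` B i)) =
    (\prod_(i in J) P (X i @^-1` B i))%E.

(* [phi i w] is the color of [i] at the sample point [w].  The first clause
   makes each [phi i] a random variable for the discrete sigma-algebra on the
   finite set of colors. *)
Definition random_coloring (R : realType) (d : measure_display)
    (T : measurableType d) (P : probability T R) (c n : nat) (p : 'I_c -> R)
    (phi : 'I_n -> T -> 'I_c) : Prop :=
  [/\ forall (i : 'I_n) (B : set 'I_c), measurable (phi i @^-1` B),
      forall (i : 'I_n) (b : 'I_c), P (phi i @^-1` [set b]) = (p b)%:E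
    & mutually_independent P phi].

Definition cvg_in_probability (R : realType) (d : nat -> measure_display)
    (T : forall n, measurableType (d n)) (P : forall n, probability (T n) R)
    (X : forall n, T n -> R) (l : R) : Prop :=
  forall eps : R, 0 < eps ->
    P n [set w | eps < `|X n w - l|] @[n --> \oo] --> 0%E.

Definition cvg_pinfty_in_probability (R : realType)
    (d : nat -> measure_display) (T : forall n, measurableType (d n))
    (P : forall n, probability (T n) R) (X : forall n, T n -> R) : Prop :=
  forall M : R, 0 < M ->
    P n [set w | M < X n w] @[n --> \oo] --> 1%E.

(* Main.v *)
(** Part (i) is a union bound: the expected number of colorful r-APs is at most
    n^(2 - sum_b w_b theta_b), and the expected number of elements of color b
    is n^(1 - theta_b).  Part (ii) is a second moment argument on the subfamily
    of the r-APs with first term x < m and difference r m + e, e < m, where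
    r^2 m <= n.  The s-th term of each of them lies in the s-th block of length
    r m, so the color it must have depends only on the element, and two
    distinct members of the family share at most one element, in the same
    position.  With mu = m^2 prod_s p(a_s), the second moment of the number of
    colorful members is at most mu + mu^2 sum_s 1 / (m p(a_s)) + mu^2, and
    both 1 / mu and 1 / (m p(a_s)) tend to 0. *)
Require Import Defs.
From mathcomp Require Import measurable_realfun lra ring zify.

Set Implicit Arguments.
Unset Strict Implicit.
Unset Printing Implicit Defensive.

Local Open Scope classical_set_scope.
Local Open Scope ring_scope.

(** * Second moment inequality for sums of indicators *)

Lemma measurable_count_le (R : realType) d (T : measurableType d) (K : finType)
    (E : K -> set T) (M : R) :
  (forall k, measurable (E k)) ->
  measurable [set w | \sum_k \1_(E k) w <= M].
Proof.
move=> mE; have mX : measurable_fun setT (fun w => \sum_k (\1_(E k) w : R)).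
  by apply: measurable_sum => k; exact: measurable_indic.
by rewrite -[X in measurable X]setTI; apply: measurable_fun_le.
Qed.

(* Chebyshev's inequality for a sum of indicators, with the cross term moved to
   the left so that only nonnegative functions are integrated. *)
Lemma second_moment_le (R : realType) d (T : measurableType d)
    (P : probability T R) (K : finType) (E : K -> set T) (M mu : R) :
  (forall k, measurable (E k)) -> 0 <= mu -> M <= mu ->
  (((mu - M) ^+ 2)%:E * P [set w | \sum_k \1_(E k) w <= M]%R
     + (mu *+ 2)%:E * \sum_k P (E k)
   <= \sum_k \sum_l P (E k `&` E l) + (mu ^+ 2)%:E)%E.
Proof.
move=> mE mu0 leM.
have mX := @measurable_count_le R _ T K E M mE.
set A := [set w | _]; rewrite -/A in mX.
have iE (B : set T) : measurable B -> P B = (\int[P]_w (\1_B w)%:E)%E.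
  by move=> mB; rewrite integral_indic// setIT.
have mi (B : set T) : measurable B ->
    measurable_fun setT (fun w => (\1_B w : R)%:E).
  by move=> mB; apply/measurable_EFinP; exact: measurable_indic.
have i0 (B : set T) w : (0 <= (\1_B w : R)%:E)%E by rewrite lee_fin.
have mEE k l : measurable (E k `&` E l) by exact: measurableI.
have -> : (\sum_k P (E k) = \int[P]_w (\sum_k (\1_(E k) w)%:E))%E.
  rewrite ge0_integral_sum//; last by move=> k; exact: mi.
  by apply: eq_bigr => k _; exact: iE.
have -> : (\sum_k \sum_l P (E k `&` E l) =
    \int[P]_w (\sum_k \sum_l (\1_(E k `&` E l) w)%:E))%E.
  rewrite ge0_integral_sum//.
  - apply: eq_bigr => k _; rewrite ge0_integral_sum//; last by move=> l; exact: mi.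
    by apply: eq_bigr => l _; exact: iE.
  - by move=> k; apply: emeasurable_sum => l; exact: mi.
  - by move=> k w _; apply: sume_ge0.
have -> : ((mu ^+ 2)%:E = \int[P]_w (cst (mu ^+ 2)%:E w))%E.
  by rewrite integral_cst// [X in (_ * X)%E]probability_setT mule1.
rewrite iE//.
have mS : measurable_fun setT (fun w => \sum_k (\1_(E k) w : R)%:E)%E.
  by apply: emeasurable_sum => l; exact: mi.
have S0 w : (0 <= \sum_k (\1_(E k) w : R)%:E)%E by exact: sume_ge0.
have mSS : measurable_fun setT (fun w => \sum_k \sum_l (\1_(E k `&` E l) w : R)%:E)%E.
  by apply: emeasurable_sum => k; apply: emeasurable_sum => l; exact: mi.
have SS0 w : (0 <= \sum_k \sum_l (\1_(E k `&` E l) w : R)%:E)%E.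
  by apply: sume_ge0 => k _; exact: sume_ge0.
rewrite -!ge0_integralZl//; [|by rewrite lee_fin mulrn_wge0|exact: mi|by rewrite lee_fin sqr_ge0].
have q0 : 0 <= (mu - M) ^+ 2 by rewrite sqr_ge0.
have m20 : 0 <= mu *+ 2 by rewrite mulrn_wge0.
rewrite -!ge0_integralD//=; first last.
- exact: measurable_funeM.
- by move=> w _; rewrite mule_ge0.
- by apply: measurable_funeM; exact: mi.
- by move=> w _; rewrite mule_ge0.
- by move=> w _; rewrite lee_fin sqr_ge0.
apply: ge0_le_integral => //=.
- by move=> w _; rewrite adde_ge0// mule_ge0.
- apply: emeasurable_funD; first by apply: measurable_funeM; exact: mi.
  exact: measurable_funeM.
- exact: emeasurable_funD.
move=> w _; pose S : R := \sum_k \1_(E k) w.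
have -> : (\sum_k (\1_(E k) w : R)%:E = S%:E)%E by rewrite sumEFin.
have -> : (\sum_k \sum_l (\1_(E k `&` E l) w : R)%:E = (S ^+ 2)%:E)%E.
  under eq_bigr do rewrite sumEFin.
  rewrite sumEFin expr2 mulr_suml; congr EFin; apply: eq_bigr => k _.
  by rewrite mulr_sumr; apply: eq_bigr => l _; rewrite indicI.
rewrite -!EFinM -!EFinD lee_fin.
(* The claim is now [(mu - M) ^+ 2 * \1_A w <= (S - mu) ^+ 2], with the square expanded; on [A] it
   follows from [S <= M <= mu]. *)
have : 0 <= (S - mu) ^+ 2 by rewrite sqr_ge0.
rewrite indicE; case: (boolP (w \in A)) => [/set_mem /= SM | _].
  suff : (mu - M) ^+ 2 <= (mu - S) ^+ 2 by rewrite mulr1; nra.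
  by rewrite ler_sqr ?nnegrE ?subr_ge0// ?lerD2l ?lerN2//; apply: le_trans leM.
by rewrite mulr0; nra.
Qed.

(** * Probabilities of prescribed color patterns *)

(** The target [g] is fixed on all of ['I_n] and only [J] varies, so that the intersection of two
    such events is again one, for the union of the sets. *)
Definition pattern (T : Type) (c n : nat) (phi : 'I_n -> T -> 'I_c)
    (g : 'I_n -> 'I_c) (J : {set 'I_n}) : set T :=
  \bigcap_(i in [set` J]) phi i @^-1` [set g i].

Lemma patternU (T : Type) (c n : nat) (phi : 'I_n -> T -> 'I_c)
    (g : 'I_n -> 'I_c) (J K : {set 'I_n}) :
  pattern phi g (J :|: K)%SET = pattern phi g J `&` pattern phi g K.
Proof.
rewrite /pattern -bigcap_setU; congr bigcap.
by apply/seteqP; split=> i /=; rewrite inE => /orP.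
Qed.

Lemma measurable_pattern (R : realType) d (T : measurableType d)
    (P : probability T R) (c n : nat) (p : 'I_c -> R) (phi : 'I_n -> T -> 'I_c)
    (g : 'I_n -> 'I_c) (J : {set 'I_n}) :
  random_coloring P p phi -> measurable (pattern phi g J).
Proof.
by move=> [mphi _ _]; apply: fin_bigcap_measurable => // i _; exact: mphi.
Qed.

Lemma prob_pattern (R : realType) d (T : measurableType d)
    (P : probability T R) (c n : nat) (p : 'I_c -> R) (phi : 'I_n -> T -> 'I_c)
    (g : 'I_n -> 'I_c) (J : {set 'I_n}) :
  random_coloring P p phi ->
  P (pattern phi g J) = (\prod_(i in J) p (g i))%:E.
Proof.
move=> [_ Pphi indep]; rewrite /pattern (indep J (fun i => [set g i])).
by rewrite -prodEFin; apply: eq_bigr.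
Qed.

(** Every factor occurs equally often on both sides. This gives the probability of a union of two
    progressions once the factors they share are divided out. *)
Lemma prodU_mul_prodI (R : comPzRingType) (I : finType) (F : I -> R)
    (A B : {set I}) :
  (\prod_(i in A :|: B) F i) * (\prod_(i in A :&: B) F i) =
  (\prod_(i in A) F i) * (\prod_(i in B) F i).
Proof.
rewrite ![\prod_(i in _) _]big_mkcond -!big_split/=; apply: eq_bigr => i _.
by rewrite !inE; do 2 case: (_ \in _); rewrite ?mulr1 ?mul1r.
Qed.

(** * A family of progressions with one term per block *)

(** The s-th term [x + s * (r * m + e)] has offset [x + s * e] in the s-th block, and this is at
    most [(m - 1) + (r - 1) * (m - 1) < r * m]. *)
Lemma modn_ap_lt (r m x e s : nat) :
  (x < m)%N -> (e < m)%N -> (s < r)%N -> (x + s * e < r * m)%N.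
Proof. by move=> xm em sr; nia. Qed.

Lemma ap_lt (r m n x e s : nat) : (r * (r * m) <= n)%N ->
  (x < m)%N -> (e < m)%N -> (s < r)%N -> (x + s * (r * m + e) < n)%N.
Proof.
move=> mn xm em sr; apply: leq_trans mn; have := modn_ap_lt xm em sr.
by move: (r * m)%N => q; nia.
Qed.

Definition ap_point (r m n : nat) (mn : (r * (r * m) <= n)%N)
    (k : 'I_m * 'I_m) (s : 'I_r) : 'I_n :=
  Ordinal (ap_lt mn (ltn_ord k.1) (ltn_ord k.2) (ltn_ord s)).

Lemma ap_point_div (r m n : nat) (mn : (r * (r * m) <= n)%N)
    (k : 'I_m * 'I_m) (s : 'I_r) : (ap_point mn k s %/ (r * m) = s)%N.
Proof.
rewrite /=; have := modn_ap_lt (ltn_ord k.1) (ltn_ord k.2) (ltn_ord s).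
move: (r * m)%N => q kq.
rewrite mulnDr addnCA divnMDl ?(leq_ltn_trans _ kq)//.
by rewrite divn_small// addn0.
Qed.

Lemma ap_point_eq_pos (r m n : nat) (mn : (r * (r * m) <= n)%N)
    (k l : 'I_m * 'I_m) (s t : 'I_r) : ap_point mn k s = ap_point mn l t -> s = t.
Proof.
move=> /(congr1 (fun i : 'I_n => i %/ (r * m))%N); rewrite !ap_point_div.
exact: val_inj.
Qed.

(** First term and difference solve two linear equations whose coefficients [s] and [t] differ. *)
Lemma ap_point_two_pos (r m n : nat) (mn : (r * (r * m) <= n)%N)
    (k l : 'I_m * 'I_m) (s t : 'I_r) : s != t ->
  ap_point mn k s = ap_point mn l s -> ap_point mn k t = ap_point mn l t -> k = l.
Proof.
case: k l => [x e] [x' e'] st [] /= hs [] /= ht.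
have st' : (s : nat) <> t by move=> /val_inj /eqP; exact/negP.
have ee : (e : nat) = e' by nia.
have xx : (x : nat) = x' by nia.
by rewrite (val_inj ee) (val_inj xx).
Qed.

Definition ap_points (r m n : nat) (mn : (r * (r * m) <= n)%N)
    (k : 'I_m * 'I_m) : {set 'I_n} := [set ap_point mn k s | s : 'I_r]%SET.

(** The required color is a function of the element, not of the progression, so one target serves
    the whole family. The default [b] is read only past the r-th block, where no [ap_point] lies. *)
Definition block_color (c r m n : nat) (b : 'I_c) (a : r.-tuple 'I_c) (i : 'I_n) : 'I_c :=
  nth b a (i %/ (r * m)).

Lemma block_color_ap_point (c r m n : nat) (mn : (r * (r * m) <= n)%N) (b : 'I_c)
    (a : r.-tuple 'I_c) (k : 'I_m * 'I_m) (s : 'I_r) :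
  block_color m b a (ap_point mn k s) = tnth a s.
Proof. by rewrite /block_color ap_point_div -tnth_nth. Qed.

Lemma prod_ap_points (R : comPzRingType) (c r m n : nat)
    (mn : (r * (r * m) <= n)%N) (b : 'I_c) (a : r.-tuple 'I_c) (p : 'I_c -> R)
    (k : 'I_m * 'I_m) :
  \prod_(i in ap_points mn k) p (block_color m b a i) =
  \prod_(s < r) p (tnth a s).
Proof.
rewrite big_imset /=; last by move=> s t _ _ /ap_point_eq_pos.
by apply: eq_bigr => s _; rewrite block_color_ap_point.
Qed.

(** * Overlapping pairs and the second moment *)

(** Equal members give [pa], members meeting in their s-th point give [pa ^+ 2 / p (tnth a s)],
    disjoint ones give [pa ^+ 2]. Adding the three cases leaves a bound that can be summed over all
    pairs term by term. *)
Lemma prodU_ap_points_le (R : realFieldType) (c r m n : nat)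
    (mn : (r * (r * m) <= n)%N) (b : 'I_c) (a : r.-tuple 'I_c) (p : 'I_c -> R)
    (k l : 'I_m * 'I_m) (pa := \prod_(s < r) p (tnth a s)) :
  (forall s, 0 < p (tnth a s)) ->
  \prod_(i in ap_points mn k :|: ap_points mn l) p (block_color m b a i) <=
  (k == l)%:R * pa
  + \sum_(s < r) (ap_point mn k s == ap_point mn l s)%:R * (pa ^+ 2 / p (tnth a s))
  + pa ^+ 2.
Proof.
move=> p0; have pa0 : 0 < pa by exact: prodr_gt0.
have S0 s : 0 <= (ap_point mn k s == ap_point mn l s)%:R * (pa ^+ 2 / p (tnth a s)).
  by rewrite mulr_ge0// divr_ge0 ?sqr_ge0// ltW.
have [->|kl] := eqVneq k l.
  rewrite finset.setUid prod_ap_points mul1r -addrA lerDl addr_ge0 ?sqr_ge0//.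
  by apply: sumr_ge0 => s _; rewrite mulr_ge0// divr_ge0 ?sqr_ge0// ltW.
rewrite mul0r add0r.
have := prodU_mul_prodI (fun i => p (block_color m b a i)) (ap_points mn k) (ap_points mn l).
rewrite !prod_ap_points -/pa -expr2.
have [/existsP[s /eqP ss]|] := boolP [exists s, ap_point mn k s == ap_point mn l s].
  (* A common point has the same position in both members, and a second common position would force
     [k = l]. *)
  have -> : (ap_points mn k :&: ap_points mn l = [set ap_point mn k s])%SET.
    apply/setP => i; rewrite !inE; apply/andP/eqP => [[/imsetP[t _ ->] /imsetP[u _ tu]]|->].
      have /esym E := ap_point_eq_pos tu; subst u.
      by have [->//|st] := eqVneq t s; move: kl; rewrite (ap_point_two_pos st tu ss) eqxx.
    by split; [|rewrite ss]; apply: imset_f.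
  rewrite big_set1 block_color_ap_point => /(canRL (mulfK _)) ->; last by rewrite gt_eqF.
  rewrite (bigD1 s)//= ss eqxx mul1r -addrA lerDl addr_ge0 ?sqr_ge0//.
  by apply: sumr_ge0.
rewrite negb_exists => /forallP kl0.
have -> : (ap_points mn k :&: ap_points mn l = finset.set0)%SET.
  apply/setP => i; rewrite !inE; apply/negP => /andP[/imsetP[t _ ->] /imsetP[u _ tu]].
  have /esym E := ap_point_eq_pos tu; subst u.
  by move: (kl0 t); rewrite tu eqxx.
by rewrite big_set0 mulr1 => ->; rewrite lerDr; apply: sumr_ge0.
Qed.

(** Given [k] and the second coordinate of [l], at most one first coordinate makes the s-th points
    agree: [m ^ 2] times [m] choices. *)
Lemma sum_ap_point_eq_le (R : realFieldType) (r m n : nat)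
    (mn : (r * (r * m) <= n)%N) (s : 'I_r) :
  \sum_(k : 'I_m * 'I_m) \sum_(l : 'I_m * 'I_m)
    (ap_point mn k s == ap_point mn l s)%:R <= m%:R ^+ 3 :> R.
Proof.
have -> : m%:R ^+ 3 = \sum_(k : 'I_m * 'I_m) m%:R :> R.
  by rewrite sumr_const card_prod card_ord -[RHS]mulr_natr natrM; ring.
apply: ler_sum => -[x e] _; rewrite -(pair_bigA _ (fun x' e' =>
  (ap_point mn (x, e) s == ap_point mn (x', e') s)%:R))/= exchange_big/=.
have -> : m%:R = \sum_(e' < m) 1 :> R by rewrite sumr_const card_ord.
apply: ler_sum => e' _.
have [/existsP[x0 /eqP xx0]|] :=
    boolP [exists x', ap_point mn (x, e) s == ap_point mn (x', e') s].
  rewrite (bigD1 x0)//= xx0 eqxx big1 ?addr0// => y yx0.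
  case: eqP => // -[] /addIn /val_inj E; by rewrite E eqxx in yx0.
rewrite negb_exists => /forallP ne; rewrite big1 ?ler01// => y _.
by rewrite (negbTE (ne y)).
Qed.

(** The summands come from the [m ^ 2] diagonal pairs, at most [m ^ 3] meeting pairs for each
    position, and all [m ^ 4] pairs. *)
Lemma sum_prodU_ap_points_le (R : realFieldType) (c r m n : nat)
    (mn : (r * (r * m) <= n)%N) (b : 'I_c) (a : r.-tuple 'I_c) (p : 'I_c -> R)
    (pa := \prod_(s < r) p (tnth a s)) :
  (forall s, 0 < p (tnth a s)) ->
  \sum_(k : 'I_m * 'I_m) \sum_(l : 'I_m * 'I_m)
    \prod_(i in ap_points mn k :|: ap_points mn l) p (block_color m b a i) <=
  m%:R ^+ 2 * pa + m%:R ^+ 3 * \sum_(s < r) (pa ^+ 2 / p (tnth a s))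
  + (m%:R ^+ 2 * pa) ^+ 2.
Proof.
move=> p0; have cardK (x : R) : \sum_(k : 'I_m * 'I_m) x = m%:R ^+ 2 * x.
  by rewrite sumr_const card_prod card_ord -[LHS]mulr_natr natrM; ring.
apply: le_trans; first by apply: ler_sum => k _; apply: ler_sum => l _; exact: prodU_ap_points_le.
under eq_bigr do rewrite !big_split/= cardK; rewrite !big_split/= cardK.
rewrite -/pa; have -> : (m%:R ^+ 2 * pa) ^+ 2 = m%:R ^+ 2 * (m%:R ^+ 2 * pa ^+ 2) by ring.
rewrite lerD2r lerD//.
  rewrite (eq_bigr (fun _ => pa)) ?cardK// => k _.
  rewrite (bigD1 k)//= eqxx mul1r big1 ?addr0// => l lk.
  by rewrite eq_sym (negbTE lk) mul0r.
under eq_bigr do rewrite exchange_big/=.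
rewrite exchange_big/= mulr_sumr; apply: ler_sum => s _.
under eq_bigr do rewrite -mulr_suml; rewrite -mulr_suml.
by rewrite ler_wpM2r ?sum_ap_point_eq_le// divr_ge0 ?sqr_ge0// ltW.
Qed.

(** * From the family to the number of colorful progressions *)

Definition ap_tuple (r m n : nat) (mn : (r * (r * m) <= n)%N)
    (k : 'I_m * 'I_m) : r.-tuple 'I_n := [tuple ap_point mn k s | s < r].

Lemma ap_tuple_inj (r m n : nat) (mn : (r * (r * m) <= n)%N) :
  (1 < r)%N -> injective (ap_tuple mn).
Proof.
move=> r1 k l kl; have r0 := ltnW r1.
have ap s : ap_point mn k s = ap_point mn l s.
  by have := congr1 (fun t => tnth t s) kl; rewrite !tnth_mktuple.
by apply: (@ap_point_two_pos _ _ _ mn k l (Ordinal r0) (Ordinal r1)) => //; exact: ap.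
Qed.

Lemma is_AP_ap_tuple (r m n : nat) (mn : (r * (r * m) <= n)%N)
  (k : 'I_m * 'I_m) : (0 < r)%N -> is_AP (ap_tuple mn k).
Proof.
move=> r0; exists k.1, (r * m + k.2)%N; split; last by move=> s; rewrite tnth_mktuple.
(* The difference is positive because [k.1] inhabits ['I_m], so [m] is positive. *)
by rewrite addn_gt0 muln_gt0 r0 (leq_ltn_trans _ (ltn_ord k.1)).
Qed.

(** [ap_tuple] injects the indices whose pattern occurs into the colorful progressions. *)
Lemma count_pattern_le_num (R : realType) d (T : measurableType d) (c r m n : nat)
    (mn : (r * (r * m) <= n)%N) (b : 'I_c) (a : r.-tuple 'I_c)
    (phi : 'I_n -> T -> 'I_c) (w : T) : (1 < r)%N ->
  \sum_(k : 'I_m * 'I_m) \1_(pattern phi (block_color m b a) (ap_points mn k)) w <=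
  (num_colorful_AP a (fun i => phi i w))%:R :> R.
Proof.
move=> r1; under eq_bigr do rewrite indicE.
rewrite -natr_sum ler_nat.
pose A := [set k | w \in pattern phi (block_color m b a) (ap_points mn k)]%SET.
have -> : (\sum_k (w \in pattern phi (block_color m b a) (ap_points mn k)) = #|A|)%N.
  rewrite -sum1_card [RHS]big_mkcond; apply: eq_bigr => k _.
  by rewrite inE; case: (_ \in _).
rewrite -(card_imset _ (ap_tuple_inj (mn:=mn) r1)); apply: subset_leq_card.
apply/fintype.subsetP => t /imsetP[k + ->]; rewrite !finset.inE => /set_mem kA.
apply/asboolP; split; first exact: is_AP_ap_tuple (ltnW r1).
move=> s; rewrite tnth_mktuple (kA _ _)/= ?block_color_ap_point//.
exact: imset_f.
Qed.

(** There are finitely many colorings, so the event is a finite union of patterns on all of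
    ['I_n]. *)
Lemma measurable_coloring (R : realType) d (T : measurableType d)
    (P : probability T R) (c n : nat) (p : 'I_c -> R) (phi : 'I_n -> T -> 'I_c)
    (Q : ('I_n -> 'I_c) -> Prop) :
  random_coloring P p phi -> measurable [set w | Q (fun i => phi i w)].
Proof.
move=> Hphi.
have -> : [set w | Q (fun i => phi i w)] =
    \bigcup_(f in [set f : {ffun 'I_n -> 'I_c} | Q f]) pattern phi f [set: 'I_n]%SET.
  apply/seteqP; split=> [w Qw|w [f /= Qf fw]] /=.
    exists [ffun i => phi i w] => /=.
      suff -> : ([ffun i => phi i w] : 'I_n -> 'I_c) = (fun i => phi i w) by [].
      by apply/funext => i; rewrite ffunE.
    by move=> i _ /=; rewrite ffunE.
  rewrite (_ : (fun i => phi i w) = f)//; apply/funext => i.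
  by apply: fw; rewrite /= inE.
by apply: fin_bigcup_measurable => // f _; exact: measurable_pattern Hphi.
Qed.

(** Chebyshev's inequality for the family; the bracket bounds the variance of its colorful count
    divided by the squared mean. *)
Lemma prob_num_gt_ge (R : realType) d (T : measurableType d)
    (P : probability T R) (c r m n : nat) (p : 'I_c -> R) (phi : 'I_n -> T -> 'I_c)
    (a : r.-tuple 'I_c) (M : R) (pa := \prod_(s < r) p (tnth a s)) :
  random_coloring P p phi -> (1 < r)%N -> (0 < m)%N -> (r * (r * m) <= n)%N ->
  (forall s, 0 < p (tnth a s)) -> M * 2 <= m%:R ^+ 2 * pa ->
  ((1 - 4 * ((m%:R ^+ 2 * pa)^-1 + \sum_(s < r) (m%:R * p (tnth a s))^-1))%:E <=
    P [set w | (M < (num_colorful_AP a (fun i => phi i w))%:R)%R])%E.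
Proof.
move=> Hphi r1 m0 mn p0 Mmu.
have b : 'I_c := tnth a (Ordinal r1).
pose g := block_color m b a : 'I_n -> 'I_c.
pose E k := pattern phi g (ap_points mn k).
have mE k : measurable (E k) by exact: measurable_pattern Hphi.
have pa0 : 0 < pa by exact: prodr_gt0.
have m0' : 0 < m%:R :> R by rewrite ltr0n.
set mu := m%:R ^+ 2 * pa; have mu0 : 0 < mu by rewrite mulr_gt0// exprn_gt0.
rewrite -/mu in Mmu *.
have mA := measurable_count_le M mE.
set A := [set w | _] in mA.
have leP : (1 - P A <= P [set w | (M < (num_colorful_AP a (fun i => phi i w))%:R)%R])%E.
  rewrite -probability_setC//; apply: le_measure; rewrite ?inE.
  - exact: measurableC.
  - exact: (@measurable_coloring _ _ _ P _ _ p _ (fun f => M < (num_colorful_AP a f)%:R)).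
  - move=> w /= /negP; rewrite -ltNge => Mw; apply: (lt_le_trans Mw).
    exact: count_pattern_le_num.
apply: le_trans leP.
pose q := fine (P A).
have PA : P A = q%:E by rewrite fineK// fin_num_measure.
have q0 : 0 <= q by exact: fine_ge0.
rewrite PA -EFinB lee_fin lerD2l lerN2.
have := second_moment_le P mE (ltW mu0) (_ : M <= mu).
rewrite -/A PA => /(_ ltac:(lra)).
have -> : (\sum_k P (E k) = mu%:E)%E.
  under eq_bigr do rewrite (prob_pattern _ _ Hphi) prod_ap_points -/pa.
  rewrite sumEFin sumr_const card_prod card_ord -[X in X%:E]mulr_natr natrM /mu.
  by congr EFin; ring.
under eq_bigr do under eq_bigr do rewrite -patternU (prob_pattern _ _ Hphi).
under eq_bigr do rewrite sumEFin.
rewrite sumEFin -!EFinM -!EFinD lee_fin.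
have := sum_prodU_ap_points_le mn b p0; rewrite -/pa -/mu -/g.
set S := \sum_k _ ; set S2 := \sum_(s < r) _ => leS.
move=> H.
have -> : \sum_(s < r) (m%:R * p (tnth a s))^-1 = m%:R ^+ 3 * S2 / mu ^+ 2.
  rewrite /S2 mulr_sumr mulr_suml; apply: eq_bigr => s _; rewrite /mu.
  by field; rewrite !gt_eqF.
have -> : 4 * (mu^-1 + m%:R ^+ 3 * S2 / mu ^+ 2) = 4 * (mu + m%:R ^+ 3 * S2) / mu ^+ 2.
  by field; rewrite gt_eqF.
rewrite ler_pdivlMr ?exprn_gt0//.
(* The [mu ^+ 2] terms cancel between [H] and [leS], leaving [(mu - M) ^+ 2 * q <= mu + m ^ 3 * S2].
   The factor 4 comes from [M <= mu / 2]. *)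
have : mu ^+ 2 <= 4 * (mu - M) ^+ 2.
  have -> : 4 * (mu - M) ^+ 2 = (2 * (mu - M)) ^+ 2 by ring.
  by rewrite ler_sqr ?nnegrE; lra.
by move=> /(ler_wpM2l q0); lra.
Qed.

(** * Union bounds on the probability of a colorful progression *)

(** The common bound [x] suits both uses: over progressions and over single elements. *)
Lemma measure_union_bound (R : realType) d (T : measurableType d)
    (P : {measure set T -> \bar R}) (K : finType) (Q : {set K}) (E : K -> set T)
    (A : set T) (x : R) :
  measurable A -> (forall k, measurable (E k)) ->
  (forall k, k \in Q -> (P (E k) <= x%:E)%E) ->
  A `<=` \bigcup_(k in [set` Q]) E k -> (P A <= (#|Q|%:R * x)%:E)%E.
Proof.
move=> mA mE PE; rewrite bigcup_pred => AE.
pose U s := \big[setU/set0]_(k <- s | k \in Q) E k.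
have mU s : measurable (U s) by apply: bigsetU_measurable => k _.
have PU s : (P (U s) <= \sum_(k <- s | k \in Q) P (E k))%E.
  elim: s => [|k s ih]; first by rewrite /U !big_nil measure0.
  rewrite /U !big_cons; case: ifP => // _; apply: le_trans (leeD2l _ ih).
  by apply: measureU2; [exact: mE|exact: mU].
apply: (@le_trans _ _ (P (U (index_enum K)))).
  by apply: le_measure; rewrite ?inE.
apply: (le_trans (PU _)).
apply: (@le_trans _ _ (\sum_(k in Q) x%:E)%E); first exact: lee_sum.
by rewrite sumEFin sumr_const mulr_natl.
Qed.

Lemma is_AP_inj (n r : nat) (t : r.-tuple 'I_n) : is_AP t -> injective (tnth t).
Proof.
move=> [x [d [d0 tE]]] s s' /(congr1 val); rewrite /= !tE => h.
by apply: val_inj => /=; nia.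
Qed.

(** A progression is determined by its first two terms. *)
Lemma card_is_AP (n r : nat) : (1 < r)%N ->
  (#|[set t : r.-tuple 'I_n | `[< is_AP t >]]%SET| <= n ^ 2)%N.
Proof.
move=> r1; pose s0 : 'I_r := Ordinal (ltnW r1); pose s1 : 'I_r := Ordinal r1.
pose f (t : r.-tuple 'I_n) := (tnth t s0, tnth t s1).
rewrite -(@card_in_imset _ _ f); last first.
  move=> t u; rewrite !finset.inE => /asboolP[x [d [d0 tE]]] /asboolP[y [e [e0 uE]]].
  case=> /(congr1 val) + /(congr1 val); rewrite /= !tE !uE/= => h0 h1.
  apply: eq_from_tnth => s; apply: val_inj; rewrite /= tE uE.
  have -> : x = y by lia.
  by have -> : d = e by lia.
by apply: leq_trans (max_card _) _; rewrite card_prod card_ord.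
Qed.

(** Union bound over at most [n ^ 2] progressions; the terms of each are distinct, so independence
    gives the product. *)
Lemma prob_num_gt0_le_sqr (R : realType) d (T : measurableType d)
    (P : probability T R) (c r n : nat) (p : 'I_c -> R) (phi : 'I_n -> T -> 'I_c)
    (a : r.-tuple 'I_c) :
  random_coloring P p phi -> (1 < r)%N -> (forall s, 0 <= p (tnth a s)) ->
  (P [set w | (0 < num_colorful_AP a (fun i => phi i w))%N] <=
    (n%:R ^+ 2 * \prod_(s < r) p (tnth a s))%:E)%E.
Proof.
move=> Hphi r1 p0; have b : 'I_c := tnth a (Ordinal r1).
(* Here the target depends on [t]: a term of [t] gets the palette color at its position, and
   elements outside [t] get the default [b]. *)
pose g (t : r.-tuple 'I_n) i := nth b a (index i t).
have gE t s : is_AP t -> g t (tnth t s) = tnth a s.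
  move=> /is_AP_inj /tuple_uniqP ut.
  by rewrite /g (tnth_nth (tnth t s)) index_uniq ?size_tuple// -tnth_nth.
pose J (t : r.-tuple 'I_n) := [set tnth t s | s : 'I_r]%SET.
pose Q := [set t : r.-tuple 'I_n | `[< is_AP t >]]%SET.
apply: (@le_trans _ _ (#|Q|%:R * \prod_(s < r) p (tnth a s))%:E); last first.
  by rewrite lee_fin ler_wpM2r ?prodr_ge0// -natrX ler_nat card_is_AP.
apply: (@measure_union_bound _ _ _ _ _ _ (fun t => pattern phi (g t) (J t))).
- exact: (measurable_coloring (fun f => (0 < num_colorful_AP a f)%N) Hphi).
- by move=> t; exact: measurable_pattern Hphi.
- move=> t; rewrite finset.inE => /asboolP tAP /=; rewrite (prob_pattern _ _ Hphi) lee_fin.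
  rewrite big_imset/=; last by move=> s s' _ _; exact: is_AP_inj.
  by under eq_bigr do rewrite gE//.
- move=> w /= /card_gt0P[t]; rewrite finset.inE => /asboolP[tAP tc].
  exists t; first by rewrite /= finset.inE; exact/asboolP.
  by move=> i /= /imsetP[s _ ->]; rewrite /= gE// tc.
Qed.

(** A colorful progression contains an element of color [tnth a s], and there are [n] candidates. *)
Lemma prob_num_gt0_le (R : realType) d (T : measurableType d)
    (P : probability T R) (c r n : nat) (p : 'I_c -> R) (phi : 'I_n -> T -> 'I_c)
    (a : r.-tuple 'I_c) (s : 'I_r) :
  random_coloring P p phi ->
  (P [set w | (0 < num_colorful_AP a (fun i => phi i w))%N] <=
    (n%:R * p (tnth a s))%:E)%E.
Proof.
move=> Hphi; have [mphi Pphi _] := Hphi.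
rewrite -[n in n%:R]card_ord -cardsT.
apply: (@measure_union_bound _ _ _ _ _ [set: 'I_n]%SET (fun i => phi i @^-1` [set tnth a s])) => //.
- exact: (measurable_coloring (fun f => (0 < num_colorful_AP a f)%N) Hphi).
- by move=> i _; rewrite /= Pphi.
- move=> w /= /card_gt0P[t]; rewrite finset.inE => /asboolP[tAP tc].
  by exists (tnth t s); [rewrite /= finset.inE|exact: tc].
Qed.

(** * Powers of n, exponents and color probabilities *)

Lemma cvg_natr_powRN (R : realType) (x : R) : 0 < x ->
  n%:R `^ (- x) @[n --> \oo] --> (0 : R).
Proof.
move=> x0; apply/cvgr0Pnorm_lt => e e0.
near=> n; rewrite ger0_norm ?powR_ge0//.
have n0 : 0 < n%:R :> R by near: n; exact: nbhs_infty_gtr.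
rewrite powRN -[ltRHS]invrK ltf_pV2 ?posrE ?invr_gt0 ?powR_gt0//.
(* This exhibits the threshold [n > (1/e)^(1/x)]. *)
have -> : e^-1 = ((e^-1) `^ x^-1) `^ x.
  by rewrite -powRrM mulVf ?gt_eqF// powRr1// invr_ge0 ltW.
rewrite gt0_ltr_powR ?nnegrE ?powR_ge0//.
by near: n; exact: nbhs_infty_gtr.
Unshelve. all: by end_near. Qed.

(** Positions are grouped by color; the fiber over [b] has [multiplicity a b] elements. *)
Lemma weighted_thetaE (R : realType) (c r : nat) (theta : 'I_c -> R)
    (a : r.-tuple 'I_c) :
  weighted_theta theta a = \sum_(s < r) theta (tnth a s).
Proof.
rewrite /weighted_theta [RHS](partition_big (tnth a) (mem (palette_colors a)))/=; last first.
  by move=> s _; rewrite finset.inE mem_tnth.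
apply: eq_bigr => b _.
rewrite (eq_bigr (fun=> theta b)); last by move=> s /eqP ->.
rewrite sumr_const mulr_natl; congr (_ *+ _).
by rewrite /multiplicity -[a in count_mem b a]map_tnth_enum count_map -size_filter cardE enumT.
Qed.

Lemma prod_color_prob (R : realType) (c r n : nat) (theta : 'I_c -> R)
    (a : r.-tuple 'I_c) : admissible a -> (0 < n)%N ->
  \prod_(s < r) color_prob theta n (tnth a s) = n%:R `^ (- weighted_theta theta a).
Proof.
move=> ha n0; rewrite weighted_thetaE -sumrN.
rewrite (big_morph (powR n%:R) (op1 := *%R) (id1 := 1)); last by rewrite powRr0.
  by apply: eq_bigr => s _; rewrite /color_prob ha.
by move=> x y; rewrite powRD// pnatr_eq0 -lt0n n0 implybT.
Qed.

(** With [0 <= x], the default 0 of the maximum cannot be what exceeds [x], so some palette color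
    does. *)
Lemma theta_maxP (R : realType) (c r : nat) (theta : 'I_c -> R)
    (a : r.-tuple 'I_c) (x : R) : 0 <= x -> x < theta_max theta a ->
  exists s, x < theta (tnth a s).
Proof.
move=> x0 /bigmax_gtP[|[b]]; first by rewrite ltNge x0.
by rewrite finset.inE => /tnthP[s ->]; exists s.
Qed.

Lemma le_theta_max (R : realType) (c r : nat) (theta : 'I_c -> R)
    (a : r.-tuple 'I_c) (s : 'I_r) : theta (tnth a s) <= theta_max theta a.
Proof. by apply: le_bigmax_cond; rewrite finset.inE mem_tnth. Qed.

Lemma cvg_sum0 (R : realType) (I : finType) (Q : pred I) (f : I -> nat -> R) :
  (forall i, Q i -> f i n @[n --> \oo] --> (0 : R)) ->
  \sum_(i | Q i) f i n @[n --> \oo] --> (0 : R).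
Proof.
move=> f0; rewrite -[X in _ --> X](@big1 R 0 +%R I (index_enum I) Q (fun=> 0))//.
by apply: (cvg_big add_continuous) => i /f0.
Qed.

(** Ensures that the coloring assumption of the theorem applies for all large [n]. *)
Lemma near_proper_color_mass_lt1 (R : realType) (c : nat) (theta : 'I_c -> R) :
  (forall b, proper_color b -> 0 < theta b) ->
  \forall n \near \oo, proper_color_mass theta n < 1.
Proof.
move=> h; have : proper_color_mass theta n @[n --> \oo] --> (0 : R).
  by apply: cvg_sum0 => b /h; exact: cvg_natr_powRN.
by move=> /cvgr_lt /(_ _ ltr01).
Qed.

Lemma color_prob_proper (R : realType) (c n : nat) (theta : 'I_c -> R) (b : 'I_c) :
  proper_color b -> color_prob theta n b = n%:R `^ (- theta b).
Proof. by rewrite /color_prob => ->. Qed.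

Lemma natr_mul_powR (R : realType) (n k : nat) (x : R) : (0 < n)%N ->
  n%:R ^+ k * n%:R `^ x = n%:R `^ (k%:R + x) :> R.
Proof.
move=> n0; rewrite powRD ?powR_mulrn//.
by rewrite pnatr_eq0 -lt0n n0 implybT.
Qed.

Lemma invr_le_mul_invr (R : realFieldType) (x y C : R) :
  0 < x -> 0 < y -> y <= C * x -> x^-1 <= C * y^-1.
Proof.
by move=> x0 y0 yx; rewrite ler_pdivlMr// mulrC ler_pdivrMr.
Qed.

Theorem theorem2p2 (R : realType) (c r : nat) (hc : (2 <= c)%N) (hr : (3 <= r)%N)
  (a : r.-tuple 'I_c) (ha : admissible a)
  (theta : 'I_c -> R)
  (htheta : forall b : 'I_c, proper_color b -> 0 < theta b)
  (d : nat -> measure_display) (T : forall n : nat, measurableType (d n))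
  (P : forall n : nat, probability (T n) R)
  (phi : forall n : nat, 'I_n -> T n -> 'I_c)
  (hphi : forall n : nat, proper_color_mass theta n < 1 ->
    random_coloring (P n) (color_prob theta n) (phi n)) :
  let X : forall n : nat, T n -> R :=
    fun n w => (num_colorful_AP a (fun i : 'I_n => phi n i w))%:R in
  (weighted_theta theta a > 2 \/ theta_max theta a > 1 ->
    cvg_in_probability P X 0) /\
  (weighted_theta theta a < 2 /\ theta_max theta a < 1 ->
    cvg_pinfty_in_probability P X).
Proof.
have r1 : (1 < r)%N by exact: ltnW.
have near_phi : \forall n \near \oo, (0 < n)%N /\
    random_coloring (P n) (color_prob theta n) (phi n).
  near=> n; split; first by near: n; exact: nbhs_infty_gt.
  by apply: hphi; near: n; exact: near_proper_color_mass_lt1.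
have mX n (Q : nat -> Prop) : random_coloring (P n) (color_prob theta n) (phi n) ->
    measurable [set w | Q (num_colorful_AP a (fun i => phi n i w))].
  by move=> Hn; exact: (measurable_coloring (fun f => Q (num_colorful_AP a f)) Hn).
move=> X; split=> [h|[W2 th1]].
  (* A count exceeding [eps > 0] is nonzero, so both cases of (i) need only a vanishing bound on the
     probability of a nonzero count. *)
  suff [u [u0 Pu]] : exists u : nat -> R, u n @[n --> \oo] --> (0 : R) /\
      \forall n \near \oo,
        (P n [set w | (0 < num_colorful_AP a (fun i => phi n i w))%N] <= (u n)%:E)%E.
    move=> eps eps0; apply: (@squeeze_cvge _ _ _ _ (fun=> 0%E) _ (fun n => (u n)%:E)).
    - near=> n; rewrite measure_ge0/=.
      have [n0 Hn] : (0 < n)%N /\ random_coloring (P n) (color_prob theta n) (phi n).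
        by near: n.
      apply: (@le_trans _ _ (P n [set w | (0 < num_colorful_AP a (fun i => phi n i w))%N])).
        apply: le_measure; rewrite ?inE.
        + exact: (mX n (fun k => eps < `|k%:R - 0|)).
        + exact: (mX n (fun k => (0 < k)%N)).
        + move=> w /=; rewrite subr0 lt0n; apply: contraTneq; rewrite /X => ->.
          by rewrite normr0 -leNgt ltW.
      by near: n.
    - exact: cvg_cst.
    - by apply: cvg_EFin u0; exact: nearW.
  case: h => [W2|/(theta_maxP ler01)[s s1]].
  - exists (fun n => n%:R `^ (- (weighted_theta theta a - 2))); split.
      by apply: cvg_natr_powRN; rewrite subr_gt0.
    apply: filterS near_phi => n [n0 Hn].
    rewrite opprB -natr_mul_powR// -prod_color_prob//.
    by apply: prob_num_gt0_le_sqr => // s; rewrite color_prob_proper ?powR_ge0.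
  - exists (fun n => n%:R `^ (- (theta (tnth a s) - 1))); split.
      by apply: cvg_natr_powRN; rewrite subr_gt0.
    apply: filterS near_phi => n [n0 Hn].
    rewrite opprB -(natr_mul_powR 1)// expr1 -color_prob_proper//.
    exact: prob_num_gt0_le.
(* With [m] the integer part of [n / r^2], this [K] satisfies [n <= K * m] for large [n]. *)
move=> M M0; pose K : R := (2 * (r * r))%:R.
have K0 : 0 < K by rewrite ltr0n !muln_gt0 (ltnW r1).
(* [v0] and [v1] will dominate the two error terms of [prob_num_gt_ge], with [m] replaced by
   [n / K]. *)
pose v0 n : R := K ^+ 2 * n%:R `^ (- (2 - weighted_theta theta a)).
pose v1 n : R := \sum_(s < r) K * n%:R `^ (- (1 - theta (tnth a s))).
have v00 : v0 n @[n --> \oo] --> (0 : R).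
  rewrite -[0](mulr0 (K ^+ 2)); apply: cvgMr.
  by apply: cvg_natr_powRN; rewrite subr_gt0.
have v10 : v1 n @[n --> \oo] --> (0 : R).
  apply: cvg_sum0 => s _; rewrite -[0](mulr0 K); apply: cvgMr.
  by apply: cvg_natr_powRN; rewrite subr_gt0 (le_lt_trans (le_theta_max _ _ _)).
(* This later yields [M * 2 <= mu], after inverting [1 / mu <= v0 n]. *)
have v0M : \forall n \near \oo, v0 n <= (M * 2)^-1.
  by move/cvgr_le : v00; apply; rewrite invr_gt0 mulr_gt0.
apply: (@squeeze_cvge _ _ _ _ (fun n => (1 - 4 * (v0 n + v1 n))%:E) _ (fun=> 1%E)); last 2 first.
- apply: cvg_EFin; first exact: nearW.
  rewrite -[X in _ --> X](_ : 1 - 4 * (0 + 0) = 1 :> R); last by ring.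
  by apply: cvgB; [exact: cvg_cst|apply: cvgMr; exact: cvgD].
- exact: cvg_cst.
near=> n.
have [n0 Hn] : (0 < n)%N /\ random_coloring (P n) (color_prob theta n) (phi n).
  by near: n.
apply/andP; split; last first.
  by apply: probability_le1; exact: (mX n (fun k => M < k%:R)).
pose m := (n %/ (r * r))%N.
have rn : (r * r <= n)%N by near: n; exact: nbhs_infty_ge.
have m0 : (0 < m)%N by rewrite divn_gt0// muln_gt0 (ltnW r1).
have mn : (r * (r * m) <= n)%N by rewrite mulnA mulnC; exact: leq_trunc_div.
(* [n < (m + 1) * r^2 <= 2 * m * r^2], since [m >= 1]. *)
have nK : n%:R <= K * m%:R.
  rewrite -natrM ler_nat; have := ltn_ceil n (_ : 0 < r * r)%N.
  by rewrite muln_gt0 (ltnW r1) -/m => /(_ isT); nia.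
have p0 s : 0 < color_prob theta n (tnth a s).
  by rewrite color_prob_proper// powR_gt0 ?ltr0n.
have n0R : 0 < n%:R :> R by rewrite ltr0n.
have m0R : 0 < m%:R :> R by rewrite ltr0n.
set pa := \prod_(s < r) color_prob theta n (tnth a s).
have pa0 : 0 < pa by exact: prodr_gt0.
have le0 : (m%:R ^+ 2 * pa)^-1 <= v0 n.
  rewrite /v0 powRN -natr_mul_powR// -prod_color_prob// -/pa.
  apply: invr_le_mul_invr; rewrite ?mulr_gt0 ?exprn_gt0//.
  rewrite mulrA -exprMn ler_wpM2r ?(ltW pa0)//.
  by rewrite ler_sqr ?nnegrE// ?mulr_ge0// ltW.
have le1 : \sum_(s < r) (m%:R * color_prob theta n (tnth a s))^-1 <= v1 n.
  apply: ler_sum => s _; rewrite powRN -(natr_mul_powR 1)// expr1 -color_prob_proper//.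
  apply: invr_le_mul_invr; rewrite ?mulr_gt0//.
  by rewrite mulrA ler_wpM2r ?(ltW (p0 s)).
apply: le_trans (prob_num_gt_ge Hn r1 m0 mn p0 _); last first.
  rewrite -/pa -lef_pV2 ?posrE ?mulr_gt0 ?exprn_gt0//; apply: (le_trans le0).
  by near: n.
by rewrite lee_fin lerD2l lerN2 ler_pM2l// lerD.
Unshelve. all: by end_near. Qed.
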